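(* Let $F\colon\mathsf{Top}\to\mathsf{Top}$ be a Vietoris polynomial functor all of whose constants are Hausdorff spaces. Then $F$ has a terminal coalgebra obtained in $\omega$ steps: the limit $V_\omega$ of the chain $1\leftarrow F1\leftarrow FF1\leftarrow\cdots$ is preserved by $F$, so the canonical morphism $m\colon FV_\omega\to V_\omega$ is an isomorphism and $m^{-1}\colon V_\omega\to FV_\omega$ is a terminal coalgebra; moreover $\nu F=V_\omega$ is a Hausdorff space.
   Context: $\mathsf{Top}$ is the category of topological spaces and continuous maps. The Vietoris functor $\mathscr{V}$ sends $X$ to the set of compact subsets of $X$ with the topology having subbase $U^{\Diamond}=\{R : R\cap U\neq\emptyset\}$, $U^{\Box}=\{R : R\subseteq U\}$ ($U$ open), and $\mathscr{V} f(A)=f[A]$. Vietoris polynomial functors are generated by the grammar $F ::= \mathscr{V} \mid A \mid \mathrm{Id} \mid \prod_{i\in I}F_i \mid \coprod_{i\in I}F_i \mid FF$, with $A$ ranging over topological spaces (constant functors), $I$ arbitrary index sets, pointwise products/coproducts and composition. Chain: $V_0=1$ (terminal space), $V_{n+1}=FV_n$, connecting maps $v_0$ unique and $v_{n+1}=Fv_n$; $V_\omega=\lim_{n<\omega}V_n$ with projections $\ell_n$; $m\colon FV_\omega\to V_\omega$ is the unique map with $\ell_{n+1}\circ m=F\ell_n$ for all $n$. *)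

(* Defs.v *)
From HB Require Import structures.
From mathcomp Require Import all_boot all_order all_algebra all_classical.
From mathcomp Require Import topology function_spaces.

Set Implicit Arguments.
Unset Strict Implicit.
Unset Printing Implicit Defensive.

Local Open Scope classical_set_scope.

(* The laws are stated with =1, which on continuousType is the same as =
   (continuousEP). *)
Record top_functor := TopFunctor {
  fun_ob :> topologicalType -> topologicalType;
  fun_map : forall X Y : topologicalType,
    continuousType X Y -> continuousType (fun_ob X) (fun_ob Y);
  fun_map_id : forall X : topologicalType, fun_map (@idfun X) =1 idfun;
  fun_map_comp : forall (X Y Z : topologicalType)
    (g : continuousType Y Z) (f : continuousType X Y),
    fun_map (g \o f) =1 fun_map g \o fun_map f }.

Record vietoris (X : topologicalType) := Vietoris {
  vietoris_set :> set X;
  vietoris_compact : compact vietoris_set }.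

Lemma vietoris_inj (X : topologicalType) (A B : vietoris X) :
  (A : set X) = B -> A = B.
Proof.
by case: A B => [A cA] [B cB] /= eAB; subst B; congr Vietoris;
   exact: Prop_irrelevance.
Qed.

Definition vdiamond (X : topologicalType) (U : set X) : set (vietoris X) :=
  [set R : vietoris X | R `&` U !=set0].
Definition vbox (X : topologicalType) (U : set X) : set (vietoris X) :=
  [set R : vietoris X | R `<=` U].

Definition vietoris_subbase (X : topologicalType) : set (set (vietoris X)) :=
  [set vdiamond U | U in open] `|` [set vbox U | U in open].

HB.instance Definition _ (X : topologicalType) := gen_eqMixin (vietoris X).
HB.instance Definition _ (X : topologicalType) := gen_choiceMixin (vietoris X).
HB.instance Definition _ (X : topologicalType) :=
  isSubBaseTopological.Build (vietoris X) (@vietoris_subbase X) id.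

Lemma vietoris_continuous (X Y : topologicalType) (f : Y -> vietoris X) :
  (forall U, open U -> open (f @^-1` vdiamond U)) ->
  (forall U, open U -> open (f @^-1` vbox U)) -> continuous f.
Proof.
move=> fD fB; apply/continuousP => _ [D sD <-].
rewrite preimage_bigcup; apply: bigcup_open => _ /sD [E sE <-].
rewrite openE => y Ey; rewrite /interior preimage_bigcap.
apply: filter_bigI => B EB; apply: open_nbhs_nbhs; split; last exact: Ey.
by have /set_mem[[U oU <-]|[U oU <-]] := sE B EB; [exact: fD|exact: fB].
Qed.

Lemma image_compact (X Y : topologicalType) (f : continuousType X Y)
  (A : set X) : compact A -> compact (f @` A).
Proof.
by apply: continuous_compact; apply: continuous_subspaceT; exact: cts_fun.
Qed.

Definition vietoris_image (X Y : topologicalType) (f : continuousType X Y)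
    (A : vietoris X) : vietoris Y :=
  Vietoris (image_compact (f := f) (vietoris_compact (v := A))).

Lemma vietoris_image_continuous (X Y : topologicalType)
  (f : continuousType X Y) : continuous (vietoris_image f).
Proof.
have oP U : open U -> open (f @^-1` U).
  by move=> oU; apply: open_comp => // x _; exact: cts_fun.
apply: vietoris_continuous => U /oP oU.
  rewrite (_ : _ @^-1` _ = vdiamond (f @^-1` U)).
    by exists [set vdiamond (f @^-1` U)]; rewrite ?bigcup_set1// => _ ->;
       apply: finI_from1; left; exists (f @^-1` U).
  apply/seteqP; split=> A /=.
    by move=> [_ [[x Ax <-] Ux]]; exists x.
  by move=> [x [Ax Ux]]; exists (f x); split=> //; exists x.
rewrite (_ : _ @^-1` _ = vbox (f @^-1` U)).
  by exists [set vbox (f @^-1` U)]; rewrite ?bigcup_set1// => _ ->;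
     apply: finI_from1; right; exists (f @^-1` U).
by apply/seteqP; split=> A /= AU; [move=> x Ax; apply: AU; exists x|
  move=> _ [x Ax <-]; exact: AU].
Qed.

HB.instance Definition _ (X Y : topologicalType) (f : continuousType X Y) :=
  isContinuous.Build _ _ (vietoris_image f) (vietoris_image_continuous (f := f)).

Lemma vietoris_image_id (X : topologicalType) :
  vietoris_image (@idfun X) =1 idfun.
Proof. by move=> A; apply: vietoris_inj; exact: image_id. Qed.

Lemma vietoris_image_comp (X Y Z : topologicalType)
  (g : continuousType Y Z) (f : continuousType X Y) :
  vietoris_image (g \o f) =1 vietoris_image g \o vietoris_image f.
Proof. by move=> A; apply: vietoris_inj => /=; rewrite image_comp. Qed.

Definition vietoris_functor : top_functor := @TopFunctor
  (fun X => vietoris X) (fun X Y f => vietoris_image f)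
  vietoris_image_id vietoris_image_comp.

Definition const_functor (A : topologicalType) : top_functor := @TopFunctor
  (fun=> A) (fun X Y f => @idfun A)
  (fun X x => erefl) (fun X Y Z g f x => erefl).

Definition id_functor : top_functor := @TopFunctor
  (fun X => X) (fun X Y f => f) (fun X x => erefl) (fun X Y Z g f x => erefl).

Section comp_functor.
Variables F G : top_functor.

Lemma comp_map_id (X : topologicalType) :
  fun_map F (fun_map G (@idfun X)) =1 idfun.
Proof.
move=> x; rewrite (_ : fun_map G (@idfun X) = @idfun (G X)) ?fun_map_id//.
by apply/continuousEP => y; exact: fun_map_id.
Qed.

Lemma comp_map_comp (X Y Z : topologicalType)
  (g : continuousType Y Z) (f : continuousType X Y) :
  fun_map F (fun_map G (g \o f))
  =1 fun_map F (fun_map G g) \o fun_map F (fun_map G f).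
Proof.
move=> x; rewrite -fun_map_comp; congr (fun_map F _ x).
by apply/continuousEP => y; exact: fun_map_comp.
Qed.

Definition comp_functor : top_functor := @TopFunctor
  (fun X => F (G X)) (fun X Y f => fun_map F (fun_map G f))
  comp_map_id comp_map_comp.

End comp_functor.

Lemma prod_continuous (I : Type) (Y : topologicalType)
    (T : I -> topologicalType) (f : Y -> prod_topology T) :
  (forall i, continuous (fun y => f y i)) -> continuous f.
Proof.
move=> fc y; apply/cvg_sup => i A [B [[C oC <-] Cy] sB].
apply: (filterS sB); apply: (fc i y); exact: open_nbhs_nbhs.
Qed.

Lemma prod_proj_continuous (I : Type) (T : I -> topologicalType) (i : I) :
  continuous (fun x : prod_topology T => x i).
Proof. exact: (@proj_continuous {classic I} T i). Qed.

Section prod_functor.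
Variables (I : Type) (F : I -> top_functor).

Definition prod_ob (X : topologicalType) : topologicalType :=
  prod_topology (fun i => F i X).

Definition prod_map (X Y : topologicalType) (f : continuousType X Y)
  (x : prod_ob X) : prod_ob Y := fun i => fun_map (F i) f (x i).

Lemma prod_map_continuous (X Y : topologicalType) (f : continuousType X Y) :
  continuous (prod_map f).
Proof.
apply: prod_continuous => i x; rewrite /prod_map.
apply: (continuous_comp (f := fun z : prod_ob X => z i)).
  exact: prod_proj_continuous.
exact: cts_fun.
Qed.

HB.instance Definition _ (X Y : topologicalType) (f : continuousType X Y) :=
  isContinuous.Build _ _ (prod_map f) (prod_map_continuous (f := f)).

Lemma prod_map_id (X : topologicalType) : prod_map (@idfun X) =1 idfun.
Proof.
by move=> x; apply: functional_extensionality_dep => i; exact: fun_map_id.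
Qed.

Lemma prod_map_comp (X Y Z : topologicalType)
  (g : continuousType Y Z) (f : continuousType X Y) :
  prod_map (g \o f) =1 prod_map g \o prod_map f.
Proof.
by move=> x; apply: functional_extensionality_dep => i; exact: fun_map_comp.
Qed.

Definition prod_functor : top_functor := @TopFunctor
  prod_ob (fun X Y f => prod_map f) prod_map_id prod_map_comp.

End prod_functor.

Section coprod_functor.
Variables (I : Type) (F : I -> top_functor).

(* {classic I} is I itself, with the choiceType structure that the library
   requires of the index of a sum topology. *)
Definition coprod_ob (X : topologicalType) : topologicalType :=
  {i : {classic I} & F i X}.

Definition coprod_map (X Y : topologicalType) (f : continuousType X Y)
  (x : coprod_ob X) : coprod_ob Y :=
  existT _ (projT1 x) (fun_map (F (projT1 x)) f (projT2 x)).

Lemma coprod_map_continuous (X Y : topologicalType) (f : continuousType X Y) :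
  continuous (coprod_map f).
Proof.
move=> [i x] U nU; exact: (@cts_fun _ _ (fun_map (F i) f) x _ nU).
Qed.

HB.instance Definition _ (X Y : topologicalType) (f : continuousType X Y) :=
  isContinuous.Build _ _ (coprod_map f) (coprod_map_continuous (f := f)).

Lemma coprod_map_id (X : topologicalType) : coprod_map (@idfun X) =1 idfun.
Proof. by move=> [i x]; rewrite /coprod_map /= fun_map_id. Qed.

Lemma coprod_map_comp (X Y Z : topologicalType)
  (g : continuousType Y Z) (f : continuousType X Y) :
  coprod_map (g \o f) =1 coprod_map g \o coprod_map f.
Proof. by move=> [i x]; rewrite /coprod_map /= fun_map_comp. Qed.

Definition coprod_functor : top_functor := @TopFunctor
  coprod_ob (fun X Y f => coprod_map f) coprod_map_id coprod_map_comp.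

End coprod_functor.

Inductive vpf :=
| VPVietoris
| VPConst of topologicalType
| VPId
| VPProd (I : Type) of (I -> vpf)
| VPCoprod (I : Type) of (I -> vpf)
| VPComp of vpf & vpf.

Fixpoint vpf_functor (F : vpf) : top_functor :=
  match F with
  | VPVietoris => vietoris_functor
  | VPConst A => const_functor A
  | VPId => id_functor
  | VPProd J G => prod_functor (fun j : J => vpf_functor (G j))
  | VPCoprod J G => coprod_functor (fun j : J => vpf_functor (G j))
  | VPComp G H => comp_functor (vpf_functor G) (vpf_functor H)
  end.

Fixpoint hausdorff_constants (F : vpf) : Prop :=
  match F with
  | VPVietoris | VPId => True
  | VPConst A => hausdorff_space A
  | VPProd J G | VPCoprod J G => forall j : J, hausdorff_constants (G j)
  | VPComp G H => hausdorff_constants G /\ hausdorff_constants H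
  end.

Record chain := Chain {
  chain_ob :> nat -> topologicalType;
  chain_map : forall n, continuousType (chain_ob n.+1) (chain_ob n) }.

Definition is_cone (C : chain) (L : topologicalType)
    (p : forall n, continuousType L (C n)) :=
  forall n, chain_map C n \o p n.+1 =1 p n.

Definition is_limit (C : chain) (L : topologicalType)
    (p : forall n, continuousType L (C n)) :=
  is_cone p /\
  forall (Y : topologicalType) (q : forall n, continuousType Y (C n)),
    is_cone q -> exists! h : continuousType Y L, forall n, p n \o h =1 q n.

Definition functor_chain (F : top_functor) (C : chain) : chain :=
  @Chain (fun n => F (C n)) (fun n => fun_map F (chain_map C n)).

Definition preserves_limit (F : top_functor) (C : chain) (L : topologicalType)
    (p : forall n, continuousType L (C n)) :=
  is_limit (C := functor_chain F C) (fun n => fun_map F (p n)).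

Section chain_limit.
Variable C : chain.

Definition threads : set (prod_topology (fun n => C n)) :=
  [set x | forall n, chain_map C n (x n.+1) = x n].

Definition chain_lim : topologicalType := threads.

Definition chain_proj (n : nat) (x : chain_lim) : C n := set_val x n.

Lemma chain_proj_continuous n : continuous (chain_proj n).
Proof.
move=> x; apply: (continuous_comp (f := set_val)
  (g := fun z : prod_topology (fun n => C n) => z n)).
  exact: initial_continuous.
exact: prod_proj_continuous.
Qed.

HB.instance Definition _ n :=
  isContinuous.Build _ _ (chain_proj n) (chain_proj_continuous (n := n)).

Lemma chain_proj_cone : is_cone (chain_proj).
Proof. by move=> n [x /= xP]; exact: (set_mem xP). Qed.

Section lift.
Variables (Y : topologicalType) (q : forall n, continuousType Y (C n)).
Hypothesis qC : is_cone q.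

Lemma chain_lift_subproof (y : Y) :
  ((fun n => q n y) : prod_topology (fun n => C n)) \in threads.
Proof. by apply: mem_set => n; exact: qC. Qed.

Definition chain_lift (y : Y) : chain_lim :=
  SigSub (chain_lift_subproof y).

Lemma chain_lift_continuous : continuous chain_lift.
Proof.
apply/continuousP => _ [B oB <-].
have /continuousP/(_ _ oB) : continuous (fun y => (fun n => q n y) : prod_topology (fun n => C n)).
  by apply: prod_continuous => n; exact: cts_fun.
by [].
Qed.

HB.instance Definition _ :=
  isContinuous.Build _ _ chain_lift chain_lift_continuous.

Lemma chain_liftK n : chain_proj n \o chain_lift =1 q n.
Proof. by []. Qed.

End lift.

Lemma chain_limP : is_limit (chain_proj).
Proof.
split=> [|Y q qC]; first exact: chain_proj_cone.
exists (chain_lift qC); split=> [n //|h hq].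
apply/continuousEP => y; apply: val_inj.
by apply: functional_extensionality_dep => n; exact: esym (hq n y).
Qed.

End chain_limit.

Definition one : topologicalType := discrete_topology unit.

Definition to_one (X : topologicalType) : continuousType X one :=
  @cst X one tt.

Lemma to_one_unique (X : topologicalType) (f : continuousType X one) :
  f = to_one X.
Proof. by apply/continuousEP => x; case: (f x). Qed.

Section terminal_chain.
Variable F : top_functor.

Fixpoint tc_ob (n : nat) : topologicalType :=
  if n is n'.+1 then F (tc_ob n') else one.

Fixpoint tc_map (n : nat) : continuousType (tc_ob n.+1) (tc_ob n) :=
  if n is n'.+1 then fun_map F (tc_map n') else to_one (F one).

Definition terminal_chain : chain := Chain tc_map.

Definition V_omega : topologicalType := chain_lim terminal_chain.

Definition tc_proj (n : nat) : continuousType V_omega (tc_ob n) :=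
  @chain_proj terminal_chain n.

Definition tc_cone (n : nat) : continuousType (F V_omega) (tc_ob n) :=
  if n is n'.+1 then fun_map F (tc_proj n') else to_one (F V_omega).

Lemma tc_coneP : is_cone (C := terminal_chain) tc_cone.
Proof.
case=> [|n] x /=; first by case: (tc_map 0 _).
have := fun_map_comp (tc_map n) (tc_proj n.+1) x; rewrite /= => <-.
congr (fun_map F _ x); apply/continuousEP => y.
exact: (@chain_proj_cone terminal_chain n y).
Qed.

Definition tc_mor : continuousType (F V_omega) V_omega := chain_lift tc_coneP.

Lemma tc_morE n : tc_proj n.+1 \o tc_mor =1 fun_map F (tc_proj n).
Proof. by []. Qed.

Lemma tc_mor_unique (h : continuousType (F V_omega) V_omega) :
  (forall n, tc_proj n.+1 \o h =1 fun_map F (tc_proj n)) -> h = tc_mor.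
Proof.
move=> hE; apply/continuousEP => x; apply: val_inj.
apply: functional_extensionality_dep => -[|n]; last exact: hE.
by case: (val (h x) 0); case: (val (tc_mor x) 0).
Qed.

End terminal_chain.

Record coalgebra (F : top_functor) := Coalgebra {
  coalg_car : topologicalType;
  coalg_str : continuousType coalg_car (F coalg_car) }.

Definition is_coalg_hom (F : top_functor) (A B : coalgebra F)
    (h : continuousType (coalg_car A) (coalg_car B)) :=
  coalg_str B \o h =1 fun_map F h \o coalg_str A.

Definition is_terminal_coalgebra (F : top_functor) (T : coalgebra F) :=
  forall A : coalgebra F,
    exists! h : continuousType (coalg_car A) (coalg_car T), is_coalg_hom h.

(* Main.v *)
(* Call a cone over an omega-chain concrete when its apex is the space of
   threads and neighbourhoods of a point are generated by the preimages of
   neighbourhoods of its projections; since the chain is directed, a single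
   index suffices.  Such a cone is a limit.  Every polynomial construction
   preserves Hausdorff spaces and concrete limits of chains of Hausdorff spaces.
   The essential case is the Vietoris functor: a thread of compact sets K_n
   comes from K = {l | p_n l in K_n for all n}, which is compact because the
   images of an ultrafilter converge to a thread (limits being unique), and
   whose projections are onto K_n by dependent choice; an open set containing a
   compact set contains the preimage, at a single stage, of an open set
   containing its projection.  The terminal chain consists of Hausdorff spaces,
   so F preserves its limit. *)

From HB Require Import structures.
Require Import Defs.
From mathcomp Require Import all_boot all_classical.
From mathcomp Require Import topology function_spaces.

Set Implicit Arguments.
Unset Strict Implicit.
Unset Printing Implicit Defensive.

Local Open Scope classical_set_scope.

(** * Choice, neighbourhoods and Hausdorff separation *)

Lemma dep_choice (I : Type) (T : I -> Type) (P : forall i, T i -> Prop) :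
  (forall i, exists x, P i x) ->
  exists x : (forall i, T i), forall i, P i (x i).
Proof.
by move=> H; exists (fun i => sval (cid (H i))) => i; exact: svalP (cid (H i)).
Qed.

Lemma continuous_nbhs (X Y : topologicalType) (f : continuousType X Y)
  (x : X) (V : set Y) : nbhs (f x) V -> nbhs x (f @^-1` V).
Proof. exact: (@cts_fun _ _ f x). Qed.

Lemma hausdorff_initial (X : topologicalType) (I : Type)
    (Y : I -> topologicalType) (f : forall i, continuousType X (Y i)) :
  (forall i, hausdorff_space (Y i)) ->
  (forall x x', (forall i, f i x = f i x') -> x = x') -> hausdorff_space X.
Proof.
move=> hY f_inj x x' xx'; apply: f_inj => i; apply: hY => A B nA nB.
have [z [Az Bz]] := xx' _ _ (continuous_nbhs nA) (continuous_nbhs nB).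
by exists (f i z).
Qed.

(** * Concrete limits of chains *)

Section concrete_limit.
Variables (C : chain) (L : topologicalType).
Variable p : forall n, continuousType L (C n).

Definition lim_nbhs (x : L) : set_system L :=
  [set A | exists n, exists2 V, nbhs (p n x) V & p n @^-1` V `<=` A].

(** [clim_nbhs] records one inclusion only: the converse is continuity of the projections. *)
Record concrete_limit := ConcreteLimit {
  clim_cone : is_cone p;
  clim_ex : forall x : (forall n, C n),
    (forall n, chain_map C n (x n.+1) = x n) -> exists l, forall n, p n l = x n;
  clim_inj : forall l l', (forall n, p n l = p n l') -> l = l';
  clim_nbhs : forall x, nbhs x `<=` lim_nbhs x }.

(** Pulling [V] back along connecting maps raises the index, and the cone law keeps its preimage in
    [L] unchanged. *)
Lemma lim_nbhs_mono (pC : is_cone p) x A n m : n <= m ->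
  (exists2 V, nbhs (p n x) V & p n @^-1` V `<=` A) ->
  exists2 V, nbhs (p m x) V & p m @^-1` V `<=` A.
Proof.
move=> /subnKC <-; elim: (m - n) => [|k IH] h; first by rewrite addn0.
have [V nV sV] := IH h; rewrite addnS; exists (chain_map C (n + k) @^-1` V).
  by apply: continuous_nbhs; have /= -> := pC (n + k) x.
by move=> z /= Vz; apply: sV; rewrite /= -(pC (n + k) z).
Qed.

Lemma lim_nbhs_filter (pC : is_cone p) x : Filter (lim_nbhs x).
Proof.
split.
- by exists 0, setT; first exact: filterT.
- move=> A B [n hA] [m hB].
  have [V nV sV] := lim_nbhs_mono pC (leq_maxl n m) hA.
  have [W nW sW] := lim_nbhs_mono pC (leq_maxr n m) hB.
  exists (maxn n m), (V `&` W); first exact: filterI.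
  by move=> z [Vz Wz]; split; [exact: sV|exact: sW].
- move=> A B AB [n [V nV sV]]; exists n, V => //.
  exact: subset_trans AB.
Qed.

Lemma concrete_limit_hausdorff : concrete_limit ->
  (forall n, hausdorff_space (C n)) -> hausdorff_space L.
Proof. by move=> cL hC; exact: hausdorff_initial hC (clim_inj cL). Qed.

Lemma concrete_limitP : concrete_limit -> is_limit p.
Proof.
move=> cL; split=> [|Y q qC]; first exact: clim_cone.
have /choice[h hE] y := clim_ex cL (fun n => qC n y).
have hc : continuous h.
  move=> y A /(clim_nbhs cL)[n [V nV sV]].
  have : nbhs y (q n @^-1` V) by apply: continuous_nbhs; rewrite -hE.
  by apply: filterS => z /= Vz; apply: sV; rewrite /= hE.
pose hT : continuousType Y L := HB.pack h (isContinuous.Build _ _ h hc).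
exists hT; split=> [n y /=|k kE]; first by rewrite hE.
by apply/continuousEP => y; apply: (clim_inj cL) => n; rewrite /= hE -kE.
Qed.

End concrete_limit.

Lemma chain_lim_concrete (C : chain) : concrete_limit (@chain_proj C).
Proof.
have pC := @chain_proj_cone C.
split=> //.
- move=> x xC; have xT : (x : prod_topology (fun n => C n)) \in @threads C.
    exact: mem_set.
  by exists (SigSub xT).
- move=> l l' ll'; apply: val_inj.
  by apply: functional_extensionality_dep => n; exact: ll'.
- move=> x A [_ [[B oB <-] Bx sBA]].
  have FF := lim_nbhs_filter pC x.
  apply: filterS sBA _.
  (* Open sets of the limit are traces of open sets of the product, so convergence in the product is
     enough; it is tested one coordinate at a time. *)
  suff : set_val @ lim_nbhs (@chain_proj C) x -->
      (set_val x : prod_topology (fun n => C n)).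
    by apply; apply: open_nbhs_nbhs.
  apply/cvg_sup => n D [E [[G oG <-] Gx] sE] /=.
  exists n, G; first exact: open_nbhs_nbhs.
  by move=> z Gz; apply: sE.
Qed.

(** * Preservation of concrete limits: constants, identity, composition *)

Definition chain_limit_preserving (F : top_functor) :=
  forall (C : chain) (L : topologicalType)
    (p : forall n, continuousType L (C n)),
  (forall n, hausdorff_space (C n)) -> concrete_limit p ->
  concrete_limit (C := functor_chain F C) (fun n => fun_map F (p n)).

Definition hausdorff_preserving (F : top_functor) :=
  forall X : topologicalType, hausdorff_space X -> hausdorff_space (F X).

Lemma functor_cone (F : top_functor) (C : chain) (L : topologicalType)
    (p : forall n, continuousType L (C n)) : is_cone p ->
  is_cone (C := functor_chain F C) (fun n => fun_map F (p n)).
Proof.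
move=> pC n x /=; have /= <- := fun_map_comp (chain_map C n) (p n.+1) x.
by congr (fun_map F _ x); apply/continuousEP; exact: pC.
Qed.

Lemma const_functor_limit (A : topologicalType) :
  chain_limit_preserving (const_functor A).
Proof.
move=> C L p hC cL; split; first exact: functor_cone (clim_cone cL).
(* All connecting maps are identities, so a thread is constant. *)
- move=> /= x xC; exists (x 0); elim=> [//|n IH].
  by rewrite xC.
- by move=> l l' /(_ 0).
- by move=> x B nB; exists 0, B.
Qed.

Lemma id_functor_limit : chain_limit_preserving id_functor.
Proof. by move=> C L p hC []. Qed.

(** Preservation by [F] is applied to the image chain under [G], whose terms are Hausdorff. *)
Lemma comp_functor_limit (F G : top_functor) :
  hausdorff_preserving G -> chain_limit_preserving F ->
  chain_limit_preserving G -> chain_limit_preserving (comp_functor F G).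
Proof.
move=> hG lF lG C L p hC cL.
exact: (lF (functor_chain G C) _ _ (fun n => hG _ (hC n)) (lG _ _ _ hC cL)).
Qed.

(** * Products *)

Section prod_functor_limit.
Variables (I : Type) (F : I -> top_functor).

Lemma prod_functor_hausdorff :
  (forall i, hausdorff_preserving (F i)) ->
  hausdorff_preserving (prod_functor F).
Proof.
move=> hF X hX.
pose f i : continuousType (prod_ob F X) (F i X) :=
  HB.pack (fun x : prod_ob F X => x i)
    (isContinuous.Build _ _ _ (@prod_proj_continuous I (fun i => F i X) i)).
apply: (hausdorff_initial (f := f)) => [i|x x' xx']; first exact: hF.
exact: functional_extensionality_dep.
Qed.

Lemma prod_functor_limit :
  (forall i, chain_limit_preserving (F i)) ->
  chain_limit_preserving (prod_functor F).
Proof.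
move=> lF C L p hC cL.
have pC := functor_cone (F := prod_functor F) (clim_cone cL).
have cF i := lF i C L p hC cL; split=> //.
- move=> /= x xC.
  have xiC i n : fun_map (F i) (chain_map C n) (x n.+1 i) = x n i.
    by rewrite -(xC n).
  have /dep_choice[l lE] i := clim_ex (cF i) (xiC i).
  by exists l => n; apply: functional_extensionality_dep => i; exact: lE.
- move=> l l' ll'; apply: functional_extensionality_dep => i.
  apply: (clim_inj (cF i)) => n; exact: (f_equal (fun h => h i) (ll' n)).
(* The stage found below depends on the coordinate [i]; the filter property of [lim_nbhs] takes care
   of finitely many coordinates. *)
- move=> x; have FF := lim_nbhs_filter pC x; apply/cvg_sup => i A.
  move=> [B [[G oG <-] Gx] sG].
  have [n [V nV sV]] := clim_nbhs (cF i) (open_nbhs_nbhs (conj oG Gx)).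
  exists n, ((fun z : prod_ob F (C n) => z i) @^-1` V).
    exact: (@prod_proj_continuous I (fun i => F i (C n)) i _ _ nV).
  by move=> z Vz; apply/sG/sV.
Qed.

End prod_functor_limit.

(** * Coproducts *)

Section coprod_functor_limit.
Variables (I : Type) (F : I -> top_functor).

Lemma coprod_functor_hausdorff :
  (forall i, hausdorff_preserving (F i)) ->
  hausdorff_preserving (coprod_functor F).
Proof. by move=> hF X hX; apply: sigT_hausdorff => i; exact: hF. Qed.

Lemma coprod_functor_limit :
  (forall i, chain_limit_preserving (F i)) ->
  chain_limit_preserving (coprod_functor F).
Proof.
move=> lF C L p hC cL.
have pC := functor_cone (F := coprod_functor F) (clim_cone cL).
have cF i := lF i C L p hC cL; split=> //.
- move=> /= x xC.
  (* Connecting maps preserve the summand, so the index of [x 0] serves the whole thread. *)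
  pose i := projT1 (x 0).
  have /dep_choice[y yE] n : exists y, x n = existT (fun i => F i (C n)) i y.
    elim: n => [|n [y yE]]; first by rewrite /i; case: (x 0) => j z; exists z.
    move: (xC n); rewrite yE; case: (x n.+1) => j z E.
    by have /= ij := existT_inj1 E; subst j; exists z.
  have yC n : fun_map (F i) (chain_map C n) (y n.+1) = y n.
    have := xC n; rewrite !yE => E; exact: (existT_inj2 (T := {classic I}) E).
  have [l lE] := clim_ex (cF i) yC.
  exists (existT _ i l) => n; rewrite yE -lE //.
- move=> [i l] [j l'] ll'; have /= ij := existT_inj1 (ll' 0); subst j.
  congr existT; apply: (clim_inj (cF i)) => n.
  exact: (existT_inj2 (T := {classic I}) (ll' n)).
- move=> [i x] A nA; have [n [V nV sV]] := clim_nbhs (cF i) nA.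
  exists n, (existT _ i @` V); first exact: existT_nbhs.
  move=> [j z] [v Vv] E; have /= ij := existT_inj1 E; subst j.
  by apply: sV => /=; rewrite -(existT_inj2 (T := {classic I}) E).
Qed.

End coprod_functor_limit.

(** * The Vietoris topology *)

Section vietoris_topology.
Variable X : topologicalType.

Lemma vdiamond_open (U : set X) : open U -> open (vdiamond U).
Proof.
move=> oU; exists [set vdiamond U]; last by rewrite bigcup_set1.
by move=> _ ->; apply: finI_from1; left; exists U.
Qed.

Lemma vbox_open (U : set X) : open U -> open (vbox U).
Proof.
move=> oU; exists [set vbox U]; last by rewrite bigcup_set1.
by move=> _ ->; apply: finI_from1; right; exists U.
Qed.

Lemma cvg_vietoris (F : set_system (vietoris X)) (K : vietoris X) : Filter F ->
  (forall U, open U -> vdiamond U K -> F (vdiamond U)) ->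
  (forall U, open U -> vbox U K -> F (vbox U)) -> F --> K.
Proof.
move=> FF FD FB A; rewrite nbhsE => -[_ [[D sD <-] [B DB BK]] sA].
apply: filterS sA _; have [E sE eB] := sD B DB.
have : F B; last by apply: filterS => R BR; exists B.
rewrite -eB; apply: filter_bigI => G EG.
have GK : G K by move: BK; rewrite -eB; apply.
have /set_mem[[U oU UG]|[U oU UG]] := sE G EG; subst G; first exact: FD.
exact: FB.
Qed.

(** A point of [K] outside [K'] is separated from the compact [K'] by disjoint open sets, which
    yield disjoint diamond and box neighbourhoods of [K] and [K']. *)
Lemma vietoris_hausdorff : hausdorff_space X -> hausdorff_space (vietoris X).
Proof.
move=> hX.
suff sub (K K' : vietoris X) : cluster (nbhs K) K' -> (K : set X) `<=` K'.
  move=> K K' KK'; apply: vietoris_inj; apply/seteqP; split; first exact: sub.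
  by apply: sub => A B nA nB; rewrite setIC; exact: KK'.
move=> KK' x Kx; apply: contrapT => K'x.
have /compact_near_coveringP cK' := vietoris_compact (v := K').
(* Each [y] in [K'] has its own [V]; compactness makes all sufficiently small [V] work for every [y]
   at once. *)
have : \forall V \near powerset_filter_from (nbhs x),
    K' `<=` [set y | nbhs y (~` V)].
  apply: cK' => y K'y.
  have : ~ cluster (nbhs x) y by move=> /hX xy; apply: K'x; rewrite xy.
  move=> /existsNP[A /existsNP[B /not_implyP[nA /not_implyP[nB AB]]]].
  exists (B°, [set V | V `<=` A]).
    by split; [exact: nbhs_interior|exact: small_set_sub].
  move=> [z V] /= [Bz VA]; apply: filterS Bz => w Bw Vw.
  by apply: AB; exists w; split=> //; exact: VA.
case/near_powerset_filter_fromP => [A B AB sB y /sB|V nV sV].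
  by apply: filterS; exact: subsetC.
have nD : nbhs K (vdiamond V°).
  apply: open_nbhs_nbhs; split; first exact/vdiamond_open/open_interior.
  by exists x.
have nB : nbhs K' (vbox (~` V)°).
  by apply: open_nbhs_nbhs; split; first exact/vbox_open/open_interior.
have [R [[z [Rz Vz]] RV]] := KK' _ _ nD nB.
exact: (interior_subset (RV z Rz)) (interior_subset Vz).
Qed.

End vietoris_topology.

(** * Ultrafilters on compact sets and threads of points *)

Lemma ultra_cvg_image (X Y : topologicalType) (f : X -> Y)
    (F : set_system X) (K : set Y) :
  UltraFilter F -> compact K -> F (f @^-1` K) -> exists2 y, K y & f @ F --> y.
Proof.
move=> FU cK FK.
have [y [Ky Fy]] := cK (f @ F) _ FK.
(* The ultrafilter contains the preimage of [V] or its complement; the latter contradicts clustering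
   at [y]. *)
exists y => // V nV; have [//|FV] := in_ultra_setVsetC (f @^-1` V) FU.
by have [z []] := Fy (~` V) V FV nV.
Qed.

(** Above index [n] preimages are chosen recursively; below it the values are forced by the
    connecting maps. *)
Lemma thread_through (C : chain) (K : forall n, set (C n)) :
  (forall n, chain_map C n @` K n.+1 = K n) ->
  forall n y, K n y -> exists x : (forall n, C n),
    [/\ forall n, chain_map C n (x n.+1) = x n, forall n, K n (x n) & x n = y].
Proof.
move=> KC n; elim: n C K KC => [|n IH] C K KC y Ky.
  have /dep_choice[s sE] n : exists s : {z | K n z} -> {z | K n.+1 z},
      forall z, chain_map C n (sval (s z)) = sval z.
    apply: (@dep_choice _ _ (fun z t => chain_map C n (sval t) = sval z)).
    case=> z /=; rewrite -KC => -[t Kt tz].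
    by exists (exist _ t Kt).
  pose x := nat_rect (fun n => {z | K n z}) (exist _ y Ky) s.
  exists (fun n => sval (x n)); split=> // m; last exact: svalP (x m).
  exact: sE.
(* Drop the first space, then prepend the image of the new [x 0]. *)
have [|x [xC Kx xy]] := IH (Chain (fun n => chain_map C n.+1))
  (fun n => K n.+1) _ y Ky; first by move=> m; exact: KC.
exists (fun m => match m with 0 => chain_map C 0 (x 0) | m'.+1 => x m' end).
split=> //; case=> //=.
by rewrite -KC; exists (x 0); first exact: Kx.
Qed.

(** * The Vietoris functor on concrete limits *)

Section vietoris_limit.
Variables (C : chain) (L : topologicalType).
Variable p : forall n, continuousType L (C n).
Hypotheses (hC : forall n, hausdorff_space (C n)) (cL : concrete_limit p).

Lemma compact_thread_preimage (K : forall n, set (C n)) :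
  (forall n, compact (K n)) -> compact [set l | forall n, K n (p n l)].
Proof.
move=> cK; rewrite compact_ultra => F FU FK.
have /dep_choice[x xP] n : exists x, K n x /\ p n @ F --> x.
  have FKn : F (p n @^-1` K n) by apply: filterS FK => l; exact.
  by have [x Kx Fx] := ultra_cvg_image FU (cK n) FKn; exists x.
have xC n : chain_map C n (x n.+1) = x n.
  have pF : ProperFilter (p n @ F) by exact: fmap_proper_filter.
  (* Both [x n] and the image of [x n.+1] are then limits of one filter in a Hausdorff space. *)
  suff Fx : p n @ F --> chain_map C n (x n.+1).
    exact: (cvg_unique (@hC n) Fx (xP n).2).
  move=> V nV; have := (xP n.+1).2 _ (continuous_nbhs nV).
  by apply: (filterS (F := F)) => l /=; have /= -> := clim_cone cL n l.
have [l lx] := clim_ex cL xC.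
exists l; split=> [n|A /(clim_nbhs cL)[n [V nV sV]]].
  by rewrite /= lx; exact: (xP n).1.
by rewrite lx in nV; exact: filterS sV ((xP n).2 V nV).
Qed.

(** [K'] is closed, and every point of [K] is in its closure because a neighbourhood is controlled
    at a single stage. *)
Lemma vietoris_proj_inj (K K' : vietoris L) :
  (forall n, p n @` K `<=` p n @` K') -> (K : set L) `<=` K'.
Proof.
move=> KK' x Kx.
have hL := concrete_limit_hausdorff cL hC.
apply: (compact_closed hL (vietoris_compact (v := K'))).
move=> A /(clim_nbhs cL)[n [V nV sV]].
have [|y K'y yx] := KK' n (p n x); first by exists x.
by exists y; split=> //; apply: sV; rewrite /= yx; exact: nbhs_singleton.
Qed.

Lemma open_proj_mono (U : set L) x n m : n <= m ->
  (exists V, [/\ open V, V (p n x) & p n @^-1` V `<=` U]) ->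
  exists V, [/\ open V, V (p m x) & p m @^-1` V `<=` U].
Proof.
move=> nm [V [oV Vx sV]].
have [|W] := lim_nbhs_mono (clim_cone cL) nm (A := U) (x := x).
  by exists V; first exact: open_nbhs_nbhs.
rewrite nbhsE => -[G [oG Gx] GW] sW; exists G; split=> //.
by move=> z Gz; apply/sW/GW.
Qed.

Lemma vietoris_functor_concrete :
  concrete_limit (C := functor_chain vietoris_functor C)
    (fun n => fun_map vietoris_functor (p n)).
Proof.
have pC := functor_cone (F := vietoris_functor) (clim_cone cL); split=> //.
- move=> /= K KC.
  have KE n : chain_map C n @` K n.+1 = K n by rewrite -[in RHS](KC n).
  have cK := compact_thread_preimage (fun n => vietoris_compact (v := K n)).
  exists (Vietoris cK) => n; apply: vietoris_inj; apply/seteqP; split=> /= y.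
    by move=> [l Kl <-]; exact: Kl.
  move=> /(thread_through KE)[x [xC Kx <-]]; have [l lx] := clim_ex cL xC.
  by exists l => [m|]; [rewrite /= lx; exact: Kx|exact: lx].
- move=> K K' KK'; have pKK' n : p n @` K = p n @` K'.
    by have /(congr1 (@vietoris_set _)) := KK' n.
  by apply: vietoris_inj; apply/seteqP; split;
    apply: vietoris_proj_inj => n; rewrite pKK'.
- move=> K; have FF := lim_nbhs_filter pC K; apply: cvg_vietoris => U oU.
    move=> [x [Kx Ux]].
    have [n [V]] := clim_nbhs cL (open_nbhs_nbhs (conj oU Ux)).
    rewrite nbhsE => -[W [oW Wx] WV] sV; exists n, (vdiamond W).
      apply: open_nbhs_nbhs; split; first exact: vdiamond_open.
      by exists (p n x); split=> //; exists x.
    move=> R [_ [[y Ry <-] Wy]]; exists y; split=> //; exact/sV/WV.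
  move=> KU.
  pose P n x := exists V, [/\ open V, V (p n x) & p n @^-1` V `<=` U].
  have /compact_near_coveringP cK := vietoris_compact (v := K).
  (* Compactness against the filter of large indices gives one stage [n] valid on all of [K]. *)
  have [|n _ /(_ n (leqnn n)) KP] := cK nat \oo P _.
    move=> x Kx.
    have [n [V]] := clim_nbhs cL (open_nbhs_nbhs (conj oU (KU x Kx))).
    rewrite nbhsE => -[W [oW Wx] WV] sV.
    exists (p n @^-1` W, [set m | n <= m]).
      by split; [exact/continuous_nbhs/open_nbhs_nbhs|exists n].
    move=> [z m] [/= Wz nm]; apply: (open_proj_mono nm); exists W; split=> //.
    by move=> w Ww; exact/sV/WV.
  (* The largest open set of stage [n] whose preimage lies in [U]. *)
  pose W := \bigcup_(V in [set V | open V /\ p n @^-1` V `<=` U]) V.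
  exists n, (vbox W).
    apply: open_nbhs_nbhs; split.
      by apply: vbox_open; apply: bigcup_open => V [].
    by move=> _ [x /KP[V [oV Vx sV]] <-]; exists V.
  move=> R RW y Ry; have [|V [_ sV] Vy] := RW (p n y); first by exists y.
  exact: sV.
Qed.

End vietoris_limit.

(** * Induction over polynomial functors *)

Lemma vpf_hausdorff (F : vpf) : hausdorff_constants F ->
  hausdorff_preserving (vpf_functor F).
Proof.
elim: F => [_|A hA|_|I G IH hG|I G IH hG|G IG H IH [hG hH]] X hX //=.
- exact: vietoris_hausdorff.
- by apply: prod_functor_hausdorff hX => i; exact: IH.
- by apply: coprod_functor_hausdorff hX => i; exact: IH.
- exact/IG/IH.
Qed.

Lemma vpf_limit (F : vpf) : hausdorff_constants F ->
  chain_limit_preserving (vpf_functor F).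
Proof.
elim: F => [_|A hA|_|I G IH hG|I G IH hG|G IG H IH [hG hH]].
- by move=> C L p; exact: vietoris_functor_concrete.
- exact: const_functor_limit.
- exact: id_functor_limit.
- by apply: prod_functor_limit => i; exact: IH.
- by apply: coprod_functor_limit => i; exact: IH.
- by apply: comp_functor_limit (IG hG) (IH hH); exact: vpf_hausdorff.
Qed.

(** * From limit preservation to the terminal coalgebra *)

Section terminal_coalgebra.
Variable F : top_functor.

Lemma tc_proj_inj (x y : V_omega F) :
  (forall n, tc_proj F n x = tc_proj F n y) -> x = y.
Proof. exact: (clim_inj (chain_lim_concrete (terminal_chain F))). Qed.

Lemma tc_projS n x : tc_map F n (tc_proj F n.+1 x) = tc_proj F n x.
Proof. exact: (@chain_proj_cone (terminal_chain F)). Qed.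

Lemma tc_mor_iso :
  preserves_limit F (C := terminal_chain F) (tc_proj F) ->
  exists2 m_inv : continuousType (V_omega F) (F (V_omega F)),
    cancel (tc_mor F) m_inv & cancel m_inv (tc_mor F).
Proof.
move=> [pC puniv].
(* The image chain is the terminal chain without its first term, so the shifted projections form a
   cone over it and induce the inverse. *)
have qC : is_cone (C := functor_chain F (terminal_chain F))
    (fun n => tc_proj F n.+1 : continuousType (V_omega F) _).
  by move=> n x; exact: (tc_projS n.+1 x).
have [g [gE _]] := puniv _ _ qC; exists g.
  have [h [_ h_uniq]] := puniv _ _ pC.
  have gm : h = (g \o tc_mor F : continuousType _ _).
    by apply: h_uniq => n x /=; have /= -> := gE n (tc_mor F x).
  have h1 : h = (@idfun (F (V_omega F)) : continuousType _ _) by apply: h_uniq.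
  by move=> x; have /continuousEP/(_ x) := etrans (esym gm) h1.
(* At index 0 both sides lie in the one-point space. *)
move=> x; apply: tc_proj_inj => -[|n]; last exact: gE n x.
by case: (tc_proj F 0 _); case: (tc_proj F 0 x).
Qed.

Lemma tc_mor_inv_terminal (m_inv : continuousType (V_omega F) (F (V_omega F))) :
  cancel (tc_mor F) m_inv -> cancel m_inv (tc_mor F) ->
  is_terminal_coalgebra (Coalgebra m_inv).
Proof.
move=> mK m_invK [A a].
(* The canonical cone that the structure map [a] induces over the terminal chain. *)
pose q := fix q n : continuousType A (tc_ob F n) :=
  if n is n'.+1 then (fun_map F (q n') \o a : continuousType _ _)
  else to_one A.
have qC : is_cone (C := terminal_chain F) q.
  elim=> [x|n IH x]; first by rewrite /=; case: (to_one _ _).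
  rewrite /=; have /= <- := fun_map_comp (tc_map F n) (q n.+1) (a x).
  by congr (fun_map F _ (a x)); apply/continuousEP; exact: IH.
(* Homomorphisms are exactly the maps mediating [q], so the limit property gives both existence and
   uniqueness. *)
have homE (h : continuousType A (V_omega F)) :
    is_coalg_hom (A := Coalgebra a) (B := Coalgebra m_inv) h <->
    forall n, tc_proj F n \o h =1 q n.
  split=> [hh|hq].
    elim=> [x|n IH x]; first by case: (q 0 x); case: (_ x).
    rewrite /= -[h x]m_invK; have /= -> := hh x.
    rewrite -[LHS]/(fun_map F (tc_proj F n) (fun_map F h (a x))).
    have /= <- := fun_map_comp (tc_proj F n) h (a x).
    by congr (fun_map F _ (a x)); apply/continuousEP; exact: IH.
  move=> x /=; apply: (can_inj mK); rewrite m_invK; apply: tc_proj_inj => -[|n].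
    by case: (tc_proj F 0 _); case: (tc_proj F 0 _).
  have /= -> := hq n.+1 x.
  rewrite -[RHS]/(fun_map F (tc_proj F n) (fun_map F h (a x))).
  have /= <- := fun_map_comp (tc_proj F n) h (a x).
  by congr (fun_map F _ (a x)); apply/continuousEP => y; rewrite -hq.
have [h [hq h_uniq]] := (chain_limP (terminal_chain F)).2 A q qC.
by exists h; split=> [|h' /homE]; [exact/homE|exact: h_uniq].
Qed.

End terminal_coalgebra.

Theorem theorem4p11 (F : vpf) (hF : hausdorff_constants F) :
  let T := vpf_functor F in
  [/\ preserves_limit T (C := terminal_chain T) (tc_proj T),
      exists m_inv : continuousType (V_omega T) (T (V_omega T)),
        [/\ cancel (tc_mor T) m_inv, cancel m_inv (tc_mor T) &
            is_terminal_coalgebra (Coalgebra m_inv)] &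
      hausdorff_space (V_omega T)].
Proof.
move=> T.
(* The chain starts at a discrete point, and each later term is [T] of the previous one. *)
have hC n : hausdorff_space (terminal_chain T n).
  by elim: n => [|n IH]; [exact: discrete_hausdorff|exact: vpf_hausdorff].
have cL := chain_lim_concrete (terminal_chain T).
have pL : preserves_limit T (C := terminal_chain T) (tc_proj T).
  exact: concrete_limitP (vpf_limit hF hC cL).
split=> //; last exact: concrete_limit_hausdorff cL hC.
have [m_inv mK m_invK] := tc_mor_iso pL.
by exists m_inv; split=> //; exact: tc_mor_inv_terminal.
Qed.
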